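(* In the setting of the context, let $\widehat\zeta\neq\zeta$ be an approximation to $\zeta$. Let $\widehat\varphi_n,\widehat b_n$ be the forward-recurrence approximations and, for each $N$, let $\widehat\varphi_n^N,\widehat b_n^N$ be the backward-recurrence approximations computed from terminal values $\widehat\varphi_N^N$ satisfying $\lambda_Np_N\widehat\varphi_N^N\to0$ as $N\to\infty$. Then (a) $\displaystyle\lim_{n\to\infty}\lim_{N\to\infty}\frac{E_{\mathrm{abs}}(\widehat\varphi_n^N)}{E_{\mathrm{abs}}(\widehat\varphi_n)}=0$; (b) $\displaystyle\lim_{n\to\infty}\lim_{N\to\infty}\frac{E_{\mathrm{abs}}(\widehat b_n^N)}{E_{\mathrm{abs}}(\widehat b_n)}=0$.
   Context: Let $\{X(t)\}_{t\ge 0}$ be a continuous-time birth--death Markov chain on $\mathbb{N}_0=\{0,1,2,\dots\}$ with birth rates $\lambda_n>0$ ($n\ge 0$), death rates $\mu_n>0$ ($n\ge 1$) and $\mu_0=0$. Set $\pi_0=1$, $\pi_n=\frac{\lambda_0\cdots\lambda_{n-1}}{\mu_1\cdots\mu_n}$ for $n\ge1$. Standing assumption: $\sum_{n\ge 0} 1/(\lambda_n\pi_n)=\infty$ and $\sum_{n\ge 0}\pi_n<\infty$ (the process is uniquely determined by its rates and ergodic). The steady-state probabilities are $p_n=\pi_n/\sum_{j\ge 0}\pi_j$. Cost rates $c_n\in\mathbb{R}$ satisfy $\sum_n |c_n|p_n<\infty$, and $\zeta:=\sum_n c_np_n$. For $z\in\mathbb{R}$ let $f_0(z)=\frac{z-c_0}{\lambda_0}$,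 $f_n(z)=\frac{z-c_n}{\lambda_n}+\frac{\mu_n}{\lambda_n}f_{n-1}(z)$, $n\ge 1$. Exact quantities: $\varphi_n:=f_n(\zeta)$ and $b_n:=b_0+\sum_{j=0}^{n-1}\varphi_j$ with $b_0\in\mathbb{R}$ given (solution of Poisson's equation). Forward recurrence: $\widehat\varphi_n:=f_n(\widehat\zeta)$, $\widehat b_0:=b_0$, $\widehat b_n:=b_0+\sum_{j=0}^{n-1}\widehat\varphi_j$. Backward recurrence: given $\widehat\varphi_N^N\in\mathbb{R}$, $\widehat\varphi_{n-1}^N=\frac{c_n-\widehat\zeta}{\mu_n}+\frac{\lambda_n}{\mu_n}\widehat\varphi_n^N$ for $n=N,N-1,\dots,1$; $\widehat b_0^N=b_0$, $\widehat b_n^N=b_0+\sum_{j=0}^{n-1}\widehat\varphi_j^N$ for $1\le n\le N$. For an approximation $\widehat x$ to $x$, $E_{\mathrm{abs}}(\widehat x):=\widehat x-x$. In (b), $n\ge 1$. *)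

(* Defs.v *)
From HB Require Import structures.
From mathcomp Require Import all_boot all_order all_algebra.
From mathcomp Require Import all_classical all_reals all_analysis.

Set Implicit Arguments.
Unset Strict Implicit.
Unset Printing Implicit Defensive.

Import Order.TTheory GRing.Theory Num.Theory.
Import numFieldNormedType.Exports.

Local Open Scope classical_set_scope.
Local Open Scope ring_scope.

(** A birth-death chain on nat is given by its rates: [lam n] is the birth rate
    and [mu n] the death rate in state [n]; [c n] is the cost rate. *)

Definition bd_pi (R : realType) (lam mu : nat -> R) (n : nat) : R :=
  (\prod_(i < n) lam i) / (\prod_(i < n) mu i.+1).

Definition bd_p (R : realType) (lam mu : nat -> R) (n : nat) : R :=
  bd_pi lam mu n / limn (series (bd_pi lam mu)).

Definition bd_zeta (R : realType) (lam mu c : nat -> R) : R :=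
  limn (series (fun n => c n * bd_p lam mu n)).

Fixpoint bd_f (R : realType) (lam mu c : nat -> R) (n : nat) (z : R) : R :=
  match n with
  | 0 => (z - c 0) / lam 0
  | m.+1 => (z - c m.+1) / lam m.+1 + mu m.+1 / lam m.+1 * bd_f lam mu c m z
  end.

Definition partial_b (R : realType) (b0 : R) (phi : nat -> R) (n : nat) : R :=
  b0 + \sum_(j < n) phi j.

Definition phi_exact (R : realType) (lam mu c : nat -> R) (n : nat) : R :=
  bd_f lam mu c n (bd_zeta lam mu c).

Definition phi_fwd (R : realType) (lam mu c : nat -> R) (zh : R) (n : nat) : R :=
  bd_f lam mu c n zh.

(** [bwd_iter lam mu c zh t N k] is the value at index [N - k] (for [k <= N])
    of the backward recurrence started at index [N] with terminal value [t]. *)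
Fixpoint bwd_iter (R : realType) (lam mu c : nat -> R) (zh t : R)
    (N k : nat) : R :=
  match k with
  | 0 => t
  | j.+1 => (c (N - j)%N - zh) / mu (N - j)%N
            + lam (N - j)%N / mu (N - j)%N * bwd_iter lam mu c zh t N j
  end.

(** [t N] is the terminal value at index [N]. Only [n <= N] is meaningful. *)
Definition phi_bwd (R : realType) (lam mu c : nat -> R) (zh : R) (t : nat -> R)
    (N n : nat) : R :=
  bwd_iter lam mu c zh (t N) N (N - n).

Lemma phi_bwd_last (R : realType) (lam mu c : nat -> R) (zh : R) (t : nat -> R)
    (N : nat) : phi_bwd lam mu c zh t N N = t N.
Proof. by rewrite /phi_bwd subnn. Qed.

Lemma phi_bwd_pred (R : realType) (lam mu c : nat -> R) (zh : R) (t : nat -> R)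
    (N n : nat) (n1 : (1 <= n)%N) (nN : (n <= N)%N) :
  phi_bwd lam mu c zh t N n.-1 =
    (c n - zh) / mu n + lam n / mu n * phi_bwd lam mu c zh t N n.
Proof.
case: n n1 nN => // n _ nN.
have e : (N - n.+1.-1 = (N - n.+1).+1)%N by rewrite subnSK.
have e' : (N - (N - n.+1) = n.+1)%N by rewrite subKn.
by rewrite /phi_bwd e [bwd_iter _ _ _ _ _ _ _.+1]/(_ + _) e'.
Qed.

Definition abs_err (R : realType) (xh x : R) : R := xh - x.

(* Main.v *)
(** Put [F_n = p_0 + .. + p_n], [K_n = c_0 p_0 + .. + c_n p_n]. By detailed
    balance both recurrences telescope after multiplication by [lam_n p_n]:
    [lam_n p_n f_n(z) = z F_n - K_n], whereas the backward values satisfy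
    [lam_n p_n phi^N_n = lam_N p_N phi^N_N + (K_N - zh F_N) - (K_n - zh F_n)].
    With [w_n = F_n / (lam_n p_n)] and [u_n = - (1 - F_n) / F_n], the forward
    error is [(zh - zeta) w_n], while the backward error tends to
    [(zh - zeta) u_n w_n] as [N] grows. The first limit ratio is thus [u_n],
    which tends to [0]; the second is the average of the [u_j], [j < n], with
    weights [w_j], which tends to [0] because the weights have infinite sum. *)

Require Import Defs.
From HB Require Import structures.
From mathcomp Require Import all_boot all_order all_algebra.
From mathcomp Require Import all_classical all_reals all_analysis.
From mathcomp Require Import ring lra.

Set Implicit Arguments.
Unset Strict Implicit.
Unset Printing Implicit Defensive.

Import Order.TTheory GRing.Theory Num.Theory.
Import numFieldNormedType.Exports.

Local Open Scope classical_set_scope.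
Local Open Scope ring_scope.

(** Past an index [m] where [|u|] is at most [e / 2], the weighted sum grows at most [e / 2] times
    as fast as the total weight; the fixed head up to [m] is absorbed since the total weight
    diverges. *)
Lemma weighted_cesaro (R : realType) (u w : nat -> R) :
  (forall n, 0 <= w n) -> series w @ \oo --> +oo -> u @ \oo --> 0 ->
  (fun n => series (fun k => u k * w k) n / series w n) @ \oo --> 0.
Proof.
move=> w_ge0 /cvgryPge Wy /cvgr0Pnorm_le u0.
apply/cvgr0Pnorm_le => e e_gt0.
have e2_gt0 : 0 < e / 2 by lra.
have [m _ um] := u0 _ e2_gt0.
set U := series (fun k => u k * w k).
have head_tail k : `|U (m + k)%N| <= `|U m| + e / 2 * series w (m + k)%N.
  elim: k => [|k IHk].
    rewrite addn0 lerDl mulr_ge0 ?(ltW e2_gt0) //.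
    exact: sumr_ge0.
  rewrite addnS /U !seriesSr (le_trans (ler_normD _ _)) //.
  rewrite mulrDr addrA lerD // normrM (ger0_norm (w_ge0 _)) ler_wpM2r //.
  by apply: um; rewrite /= leq_addr.
near=> n.
have mn : (m <= n)%N by near: n; exact: nbhs_infty_ge.
(* The first summand makes the head at most [e / 2 * series w n]; the extra [1] keeps the
   denominator positive. *)
have Wn : `|U m| / (e / 2) + 1 <= series w n by near: n; exact: Wy.
have Wn_gt0 : 0 < series w n.
  by apply: lt_le_trans Wn; rewrite ltr_wpDl // divr_ge0 // ltW.
rewrite normrM normfV (gtr0_norm Wn_gt0) ler_pdivrMr //.
have := head_tail (n - m)%N; rewrite subnKC // => /le_trans; apply.
have Um : `|U m| <= e / 2 * series w n.
  by rewrite mulrC -ler_pdivrMr // (le_trans _ Wn) // lerDl.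
by rewrite [X in _ <= X * _]splitr mulrDl lerD2r.
Unshelve. all: by end_near. Qed.

Lemma cvg_series_pointwise (R : realType) (f : nat -> nat -> R) (l : nat -> R)
    (n : nat) :
  (forall j, f ^~ j @ \oo --> l j) ->
  (fun N => series (f N) n) @ \oo --> series l n.
Proof.
move=> fl; elim: n => [|n IHn].
  rewrite (eq_cvg _ _ (g := cst 0)) => [|N]; last by rewrite /series /= big_nil.
  by rewrite /series /= big_nil; exact: cvg_cst.
rewrite seriesSr (eq_cvg _ _ (g := fun N => series (f N) n + f N n)).
  exact: cvgD.
by move=> N; rewrite seriesSr.
Qed.

Lemma partial_b_sub (R : realType) (b0 : R) (f g : nat -> R) (n : nat) :
  partial_b b0 f n - partial_b b0 g n = series (fun k => f k - g k) n.
Proof.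
by rewrite /partial_b opprD addrACA subrr add0r -sumrB /series /= big_mkord.
Qed.

(** In the code [F n] and [K n] are sums over [j < n], so the [F_n] and [K_n] of
    the introduction are [F n.+1] and [K n.+1]. *)
Section birth_death.
Context (R : realType) (lam mu c : nat -> R).
Hypothesis lam_gt0 : forall n, 0 < lam n.
Hypothesis mu_gt0 : forall n, (1 <= n)%N -> 0 < mu n.
Hypothesis cvg_pi : cvgn (series (bd_pi lam mu)).
Hypothesis cvg_cost : cvgn (series (fun n => `|c n| * bd_p lam mu n)).

Local Notation p := (bd_p lam mu).
Local Notation S := (limn (series (bd_pi lam mu))).
Local Notation zeta := (bd_zeta lam mu c).
Local Notation F := (series p).
Local Notation K := (series (fun n => c n * p n)).

Lemma bd_pi_gt0 n : 0 < bd_pi lam mu n.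
Proof. by rewrite divr_gt0 ?prodr_gt0 // => i _; exact: mu_gt0. Qed.

Lemma bd_pi_series_ge1 n : 1 <= series (bd_pi lam mu) n.+1.
Proof.
rewrite /series /= big_nat_recl // {1}/bd_pi !big_ord0 divr1 lerDl sumr_ge0 //.
by move=> i _; exact: ltW (bd_pi_gt0 _).
Qed.

Lemma bd_pi_sum_ge1 : 1 <= S.
Proof.
apply: limr_ge; first exact: cvg_pi.
(* The empty partial sum is 0, so the bound starts at index 1. *)
by exists 1%N => // -[//|n] _ /=; exact: bd_pi_series_ge1.
Qed.

Lemma bd_pi_sum_gt0 : 0 < S.
Proof. exact: lt_le_trans bd_pi_sum_ge1. Qed.

Lemma bd_p_gt0 n : 0 < p n.
Proof. by rewrite divr_gt0 ?bd_pi_gt0 ?bd_pi_sum_gt0. Qed.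

Lemma detailed_balance n : mu n.+1 * p n.+1 = lam n * p n.
Proof.
have mun : mu n.+1 != 0 by rewrite gt_eqF ?mu_gt0.
have P : \prod_(i < n) mu i.+1 != 0.
  by apply/prodf_neq0 => i _; rewrite gt_eqF ?mu_gt0.
have S0 := lt0r_neq0 bd_pi_sum_gt0.
by rewrite /bd_p /bd_pi !big_ord_recr /=; field; rewrite mun P S0.
Qed.

Lemma bd_p_seriesE n : F n = series (bd_pi lam mu) n / S.
Proof. by rewrite /series /= mulr_suml. Qed.

Lemma cvg_bd_p_series : F @ \oo --> (1 : R).
Proof.
rewrite (eq_cvg _ _ bd_p_seriesE) -(divff (lt0r_neq0 bd_pi_sum_gt0)).
apply: cvgMl; exact: cvg_pi.
Qed.

Lemma bd_p_series_gt0 n : 0 < F n.+1.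
Proof.
rewrite bd_p_seriesE divr_gt0 ?bd_pi_sum_gt0 //.
exact: lt_le_trans (bd_pi_series_ge1 n).
Qed.

Lemma cvg_cost_series : K @ \oo --> zeta.
Proof.
(* As [p] is positive, the cost hypothesis is absolute convergence; this makes [zeta], defined by
   [limn], a genuine limit. *)
apply: normed_cvg.
rewrite [X in cvgn (series X)](_ : _ = fun n => `|c n| * p n) //.
by apply/funext => n /=; rewrite normrM (gtr0_norm (bd_p_gt0 n)).
Qed.

(** After multiplication by [lam n * p n], detailed balance turns each step of the recurrence into
    adding [(z - c n) * p n]. *)
Lemma bd_fE n z : bd_f lam mu c n z = (z * F n.+1 - K n.+1) / (lam n * p n).
Proof.
have p0 k : p k != 0 by rewrite gt_eqF ?bd_p_gt0.
have l0 k : lam k != 0 by rewrite gt_eqF.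
elim: n => [|n IHn] /=.
  rewrite !seriesSr /series /= !big_nil; field.
  by rewrite p0 l0.
(* Eliminating [mu] leaves a rational identity in [lam], [p] and the partial sums. *)
have -> : mu n.+1 = lam n * p n / p n.+1.
  by rewrite -detailed_balance mulfK.
rewrite IHn [F n.+2]seriesSr [K n.+2]seriesSr; field.
by rewrite !p0 !l0.
Qed.

Lemma phi_bwdE zh t N n : (n <= N)%N ->
  phi_bwd lam mu c zh t N n =
  (lam N * p N * t N + (K N.+1 - zh * F N.+1) - (K n.+1 - zh * F n.+1))
    / (lam n * p n).
Proof.
have p0 k : p k != 0 by rewrite gt_eqF ?bd_p_gt0.
have l0 k : lam k != 0 by rewrite gt_eqF.
(* The recurrence runs down from [N], so the induction is on the distance [k = N - n] to the
   terminal index. *)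
move=> nN; rewrite -(subKn nN); move: (leq_subr n N).
elim: (N - n)%N => [_|k IHk kN].
  by rewrite subn0 phi_bwd_last addrK mulrC mulKf // mulf_neq0.
have Nk : (N - k = (N - k.+1).+1)%N by rewrite subnSK.
have := @phi_bwd_pred R lam mu c zh t N (N - k)%N.
rewrite subn_gt0 leq_subr kN => /(_ isT isT).
rewrite IHk ?(ltnW kN) // Nk /= => ->.
set m := (N - k.+1)%N.
have -> : mu m.+1 = lam m * p m / p m.+1.
  by rewrite -detailed_balance mulfK.
rewrite [F m.+2]seriesSr [K m.+2]seriesSr; field.
by rewrite !p0 !l0.
Qed.

Lemma phi_fwd_err zh n :
  phi_fwd lam mu c zh n - phi_exact lam mu c n =
  (zh - zeta) * (F n.+1 / (lam n * p n)).
Proof. by rewrite /phi_fwd /phi_exact !bd_fE; ring. Qed.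

Lemma cvg_phi_bwd_err zh t n : (fun N => lam N * p N * t N) @ \oo --> 0 ->
  (fun N => phi_bwd lam mu c zh t N n - phi_exact lam mu c n) @ \oo -->
  (zh - zeta) * (- ((F n.+1)^-1 - 1) * (F n.+1 / (lam n * p n))).
Proof.
move=> t0.
have F0 := lt0r_neq0 (bd_p_series_gt0 n).
have a0 : lam n * p n != 0 by rewrite mulf_neq0 ?gt_eqF ?bd_p_gt0.
(* The right-hand side is the closed form [phi_bwdE] with the terminal term, [K N.+1] and [F N.+1]
   replaced by their limits [0], [zeta] and [1]. *)
have -> : (zh - zeta) * (- ((F n.+1)^-1 - 1) * (F n.+1 / (lam n * p n))) =
    (0 + (zeta - zh * 1) - (K n.+1 - zh * F n.+1)) / (lam n * p n)
      - phi_exact lam mu c n.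
  rewrite /phi_exact bd_fE; field.
  by move: a0; rewrite mulf_eq0 F0 => /norP[-> ->].
have FS : (fun N => F N.+1) @ \oo --> (1 : R).
  by have := cvg_bd_p_series; rewrite -cvg_shiftS.
have KS : (fun N => K N.+1) @ \oo --> zeta.
  by have := cvg_cost_series; rewrite -cvg_shiftS.
apply: cvgB; last exact: cvg_cst.
(* The closed form is available only for [n <= N], hence eventually in [N]. *)
apply: (@cvg_trans _ ((fun N => (lam N * p N * t N + (K N.+1 - zh * F N.+1)
    - (K n.+1 - zh * F n.+1)) / (lam n * p n)) @ \oo)).
  apply: near_eq_cvg; exists n => // N /= nN.
  by rewrite phi_bwdE.
apply: cvgMl; apply: cvgB; last exact: cvg_cst.
apply: cvgD => //; apply: cvgB => //.
by apply: cvgMr.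
Qed.

Lemma cvg_tail_ratio : (fun n => - ((F n.+1)^-1 - 1)) @ \oo --> (0 : R).
Proof.
have FS : (fun N => F N.+1) @ \oo --> (1 : R).
  by have := cvg_bd_p_series; rewrite -cvg_shiftS.
have -> : 0 = - (1^-1 - 1) :> R by rewrite invr1 subrr oppr0.
apply: cvgN; apply: cvgB; last exact: cvg_cst.
by apply: cvgV.
Qed.

(** The normalising constant cancels in the weights, whose numerators become partial sums of
    [bd_pi]. These are at least [bd_pi lam mu 0 = 1], so the weights dominate the terms of the
    divergent series. *)
Lemma cvgy_fwd_weight :
  series (fun n => (lam n * bd_pi lam mu n)^-1) @ \oo --> +oo ->
  series (fun n => F n.+1 / (lam n * p n)) @ \oo --> +oo.
Proof.
apply: ger_cvgy; apply: nearW => n; apply: ler_sum => k _.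
have a_gt0 : 0 < lam k * bd_pi lam mu k by rewrite mulr_gt0 ?bd_pi_gt0.
have -> : F k.+1 / (lam k * p k) =
    series (bd_pi lam mu) k.+1 / (lam k * bd_pi lam mu k).
  rewrite bd_p_seriesE /bd_p; field.
  by rewrite !gt_eqF ?bd_pi_gt0 ?bd_pi_sum_gt0.
by rewrite ler_pdivlMr // mulVf ?gt_eqF // bd_pi_series_ge1.
Qed.

End birth_death.

Theorem proposition6p5 (R : realType) (lam mu c : nat -> R)
    (b0 zh : R) (t : nat -> R)
    (lam_gt0 : forall n, 0 < lam n)
    (mu_gt0 : forall n, (1 <= n)%N -> 0 < mu n)
    (mu0 : mu 0%N = 0)
    (div_sum : series (fun n => (lam n * bd_pi lam mu n)^-1) @ \oo --> +oo)
    (cvg_pi : cvgn (series (bd_pi lam mu)))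
    (cvg_cost : cvgn (series (fun n => `|c n| * bd_p lam mu n)))
    (zh_neq : zh != bd_zeta lam mu c)
    (terminal : (fun N => lam N * bd_p lam mu N * t N) @ \oo --> 0) :
  let phi := phi_exact lam mu c in
  let phiF := phi_fwd lam mu c zh in
  let phiB := phi_bwd lam mu c zh t in
  let b := partial_b b0 phi in
  let bF := partial_b b0 phiF in
  let bB := fun N => partial_b b0 (phiB N) in
  let ratio_phi := fun n N =>
    abs_err (phiB N n) (phi n) / abs_err (phiF n) (phi n) in
  let ratio_b := fun n N =>
    abs_err (bB N n) (b n) / abs_err (bF n) (b n) in
  [/\ forall n, abs_err (phiF n) (phi n) != 0,
      forall n, cvgn (ratio_phi n) &
      (fun n => limn (ratio_phi n)) @ \oo --> 0] /\
  [/\ forall n, (1 <= n)%N -> abs_err (bF n) (b n) != 0,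
      forall n, (1 <= n)%N -> cvgn (ratio_b n) &
      (fun n => limn (ratio_b n)) @ \oo --> 0].
Proof.
move=> phi phiF phiB b bF bB ratio_phi ratio_b.
set w := fun n => series (bd_p lam mu) n.+1 / (lam n * bd_p lam mu n).
set u := fun n => - ((series (bd_p lam mu) n.+1)^-1 - 1).
set d := zh - bd_zeta lam mu c.
have d0 : d != 0 by rewrite subr_eq0.
have w_gt0 n : 0 < w n.
  by rewrite divr_gt0 ?bd_p_series_gt0 // mulr_gt0 ?bd_p_gt0.
have W_gt0 n : (1 <= n)%N -> 0 < series w n.
  case: n => // n _; rewrite seriesSr ltr_wpDl // sumr_ge0 // => i _.
  exact: ltW.
have errF n : abs_err (phiF n) (phi n) = d * w n by exact: phi_fwd_err.
have errB n : (fun N => abs_err (phiB N n) (phi n)) @ \oo --> d * (u n * w n).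
  exact: cvg_phi_bwd_err.
have errbF n : abs_err (bF n) (b n) = d * series w n.
  rewrite /abs_err partial_b_sub /series /= mulr_sumr.
  by apply: eq_bigr => k _; exact: errF.
have errbB n : (fun N => abs_err (bB N n) (b n)) @ \oo -->
    d * series (fun k => u k * w k) n.
  (* With [d] moved inside, this is a sum of [n] terms, [n] independent of [N], so the limit in [N]
     is taken termwise from [errB]. *)
  rewrite (_ : d * _ = series (fun k => d * (u k * w k)) n); last first.
    by rewrite /series /= mulr_sumr.
  rewrite (eq_cvg _ _ (fun N => partial_b_sub b0 (phiB N) phi n)).
  exact: (@cvg_series_pointwise _ (fun N k => phiB N k - phi k)).
have u0 : u @ \oo --> 0 by exact: cvg_tail_ratio.
have lim_phi n : ratio_phi n @ \oo --> u n.
  have -> : u n = d * (u n * w n) / (d * w n).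
    by field; rewrite d0 gt_eqF.
  by rewrite /ratio_phi errF; apply: cvgMl; exact: errB.
have lim_b n : (1 <= n)%N ->
    ratio_b n @ \oo --> series (fun k => u k * w k) n / series w n.
  move=> n1.
  have -> : series (fun k => u k * w k) n / series w n =
      d * series (fun k => u k * w k) n / (d * series w n).
    by rewrite -mulf_div divff // mul1r.
  by rewrite /ratio_b errbF; apply: cvgMl; exact: errbB.
split; split.
- by move=> n; rewrite errF mulf_neq0 // gt_eqF.
- by move=> n; apply: cvgP (lim_phi n).
- by rewrite (eq_cvg _ _ (g := u)) // => n; apply: cvg_lim.
- by move=> n n1; rewrite errbF mulf_neq0 // gt_eqF ?W_gt0.
- by move=> n n1; apply: cvgP (lim_b n n1).
(* The inner limit equals the weighted average of the [u k] only from [n = 1] on, since at [n = 0]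
   both errors vanish. *)
- apply: cvg_trans (weighted_cesaro (fun n => ltW (w_gt0 n)) _ u0); last first.
    exact: cvgy_fwd_weight.
  apply: near_eq_cvg; exists 1%N => // n /= n1.
  by apply/esym/cvg_lim => //; exact: lim_b.
Qed.
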